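(* Let $B$ be a weighted bicyclic graph and let $\chi_B$ be the base of $B$ (with the weights inherited from $B$). (i) If $B$ is of Type I and $v\in\chi_B$ is matched in $B\{v\}$, then $$i_+(B)=i_+(B\{v\})+i_+(B-B\{v\}),\qquad i_-(B)=i_-(B\{v\})+i_-(B-B\{v\}).$$ Moreover, $B\{v\}$ is a tree, and $B-B\{v\}$ is a disjoint union of weighted unicyclic graphs and trees. (ii) If $B$ is of Type II, then $$i_+(B)=i_+(B-\chi_B)+i_+(\chi_B),\qquad i_-(B)=i_-(B-\chi_B)+i_-(\chi_B).$$
   Context: A weighted graph is a finite simple graph $G$ together with a weight function assigning a positive real number $w(e)>0$ to each edge $e$. If $V_G=\{v_1,\dots,v_n\}$, its weighted adjacency matrix $A(G)=(a_{ij})$ is the real symmetric $n\times n$ matrix with $a_{ij}=w(v_iv_j)$ if $v_iv_j$ is an edge and $a_{ij}=0$ otherwise. $i_+(G)$ and $i_-(G)$ denote the numbers of positive and negative eigenvalues of $A(G)$, counted with multiplicity (both are $0$ for the empty graph). Subgraphs carry the inherited weights. For an induced subgraph $H$ of $G$, $G-H$ is obtained from $G$ by deleting all vertices of $H$ and all edges incident with them. A tree (resp. unicyclic graph, bicyclic graph) is a simple connected graph whose number of edges equals its number of vertices plus $-1$ (resp. $0$, $1$). A vertex $v$ of a tree $T$ with at least two vertices is called mismatched in $T$ if some maximum matching of $T$ does not cover $v$, and matched in $T$ otherwise; the vertex of a one-vertex tree is considered mismatched. An $\infty$-graph $\infty(p,l,q)$ ($p,q\ge 3$, $l\ge1$)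 is obtained from two vertex-disjoint cycles $C_p=u_1\cdots u_pu_1$ and $C_q=v_1\cdots v_qv_1$ by joining $u_1$ and $v_1$ by a path of length $l-1$ (for $l=1$, $u_1$ and $v_1$ are identified). A $\theta$-graph $\theta(p,l,q)$ ($\min\{p,l,q\}\ge2$, at most one of $p,l,q$ equal to $2$) is obtained from three vertex-disjoint paths on $p$, $l$, $q$ vertices by identifying their three initial vertices and identifying their three terminal vertices. Every bicyclic graph $B$ contains as an induced subgraph exactly one graph that is an $\infty$-graph or a $\theta$-graph; this is called the base of $B$, denoted $\chi_B$. For a weighted bicyclic graph $B$ and a vertex $v\in\chi_B$, $B\{v\}$ denotes the induced connected weighted subgraph of $B$ with the maximum possible number of vertices which contains $v$ and no other vertex of $\chi_B$. $B$ is of Type I if there is a vertex $v$ on $\chi_B$ such that $v$ is matched in $B\{v\}$; otherwise $B$ is of Type II. *)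

(* Defs.v *)
From mathcomp Require Import all_boot all_order all_algebra.
From mathcomp Require Import polyrcf.
Set Implicit Arguments.
Unset Strict Implicit.
Unset Printing Implicit Defensive.
Import Order.TTheory GRing.Theory Num.Theory.
Local Open Scope ring_scope.

(** The real numbers are abstracted to an arbitrary real closed field [R]. *)

(** [wt x y] is meaningful only when [edge x y]; its values on non-edges are
    junk and never used. *)
Record wgraph (R : rcfType) := WGraph {
  vertex :> finType;
  edge : rel vertex;
  wt : vertex -> vertex -> R;
  edge_sym : symmetric edge;
  edge_irr : irreflexive edge;
  wt_sym : forall x y, wt x y = wt y x;
  wt_gt0 : forall x y, edge x y -> 0 < wt x y
}.

Section InducedSubgraph.
Variables (R : rcfType) (G : wgraph R) (S : {set G}).

Definition induced_vertex : finType := {x : G | x \in S}.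
Definition induced_edge : rel induced_vertex :=
  fun x y => edge (val x) (val y).
Definition induced_wt (x y : induced_vertex) : R := wt (val x) (val y).

Fact induced_edge_sym : symmetric induced_edge.
Proof. by move=> x y; exact: edge_sym. Qed.
Fact induced_edge_irr : irreflexive induced_edge.
Proof. by move=> x; exact: edge_irr. Qed.
Fact induced_wt_sym x y : induced_wt x y = induced_wt y x.
Proof. exact: wt_sym. Qed.
Fact induced_wt_gt0 x y : induced_edge x y -> 0 < induced_wt x y.
Proof. exact: wt_gt0. Qed.

Definition induced : wgraph R :=
  WGraph induced_edge_sym induced_edge_irr induced_wt_sym induced_wt_gt0.

End InducedSubgraph.

Definition delete (R : rcfType) (G : wgraph R) (S : {set G}) : wgraph R :=
  induced (~: S).

Section Inertia.
Variable R : rcfType.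

Definition adjacency (G : wgraph R) : 'M[R]_#|G| :=
  \matrix_(i, j) if edge (enum_val i) (enum_val j)
                 then wt (enum_val i) (enum_val j) else 0.

(** [rootsR p] lists the distinct roots of [p] in [R], each one once, and
    [mup a p] is the multiplicity of [a] as a root of [p]. *)
Definition i_pos (G : wgraph R) : nat :=
  (\sum_(a <- rootsR (char_poly (adjacency G)) | (0 < a)%R)
     mup a (char_poly (adjacency G)))%N.

Definition i_neg (G : wgraph R) : nat :=
  (\sum_(a <- rootsR (char_poly (adjacency G)) | (a < 0)%R)
     mup a (char_poly (adjacency G)))%N.

End Inertia.

Section Graphs.
Variable R : rcfType.
Implicit Types G : wgraph R.

Definition edges G : {set {set G}} :=
  [set [set p.1; p.2] | p : G * G & edge p.1 p.2].

(** The empty graph is not connected. *)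
Definition connected_graph G : bool :=
  (0 < #|G|)%N && [forall x : G, forall y : G, connect (@edge R G) x y].

Definition is_tree G : bool :=
  connected_graph G && (#|edges G|.+1 == #|G|)%N.
Definition is_unicyclic G : bool :=
  connected_graph G && (#|edges G| == #|G|)%N.
Definition is_bicyclic G : bool :=
  connected_graph G && (#|edges G| == #|G|.+1)%N.

(** [P] is the set of the vertex sets of the summands. *)
Definition is_disjoint_union (Q : wgraph R -> bool) G : Prop :=
  exists P : {set {set G}},
    [/\ partition P [set: G],
        forall x y : G, edge x y -> pblock P x = pblock P y
      & forall S : {set G}, S \in P -> Q (induced S)].

Definition is_matching G (M : {set {set G}}) : bool :=
  (M \subset edges G) && trivIset M.

Definition is_maximum_matching G (M : {set {set G}}) : bool :=
  is_matching M && [forall N : {set {set G}}, is_matching N ==> (#|N| <= #|M|)%N].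

(** In a one-vertex graph the only matching is empty, so that its vertex is
    mismatched, in agreement with the convention for one-vertex trees. *)
Definition mismatched G (v : G) : bool :=
  [exists M : {set {set G}}, is_maximum_matching M && (v \notin cover M)].

Definition matched G (v : G) : bool := ~~ mismatched v.

Definition matched_in G (S : {set G}) (v : G) : bool :=
  [exists x : induced S, (val x == v) && matched x].

End Graphs.

Section Bicyclic.
Variable R : rcfType.
Implicit Types G : wgraph R.

(** [x] and [y] are consecutive, in either order, in the sequence [s]. *)
Definition consecutive (T : eqType) (s : seq T) (x y : T) : bool :=
  infix [:: x; y] s || infix [:: y; x] s.

(** The cycles are [u :: c] and [v :: d]; the path [u :: m] goes from [u] to
    [v], so that [u = v] when [l = 1]. *)
Definition is_infty_graph (p l q : nat) G : Prop :=
  exists (u : G) (c m d : seq G),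
    let v := last u m in
    [/\ [/\ size (u :: c) = p, size (u :: m) = l & size (v :: d) = q],
        uniq (c ++ (u :: m) ++ d),
        forall x : G, x \in c ++ (u :: m) ++ d
      & forall x y : G,
          edge x y = [|| consecutive (u :: rcons c u) x y,
                         consecutive (u :: m) x y
                       | consecutive (v :: rcons d v) x y]].

(** The three paths are [a :: rcons s_i b], with internal vertices [s_i]. *)
Definition is_theta_graph (p l q : nat) G : Prop :=
  exists (a b : G) (s1 s2 s3 : seq G),
    [/\ [/\ size (a :: rcons s1 b) = p, size (a :: rcons s2 b) = l
          & size (a :: rcons s3 b) = q],
        uniq ([:: a; b] ++ s1 ++ s2 ++ s3),
        forall x : G, x \in [:: a; b] ++ s1 ++ s2 ++ s3
      & forall x y : G,
          edge x y = [|| consecutive (a :: rcons s1 b) x y,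
                         consecutive (a :: rcons s2 b) x y
                       | consecutive (a :: rcons s3 b) x y]].

Definition is_base G (X : {set G}) : Prop :=
  (exists p l q : nat,
     [/\ (3 <= p)%N, (1 <= l)%N, (3 <= q)%N & is_infty_graph p l q (induced X)])
  \/
  (exists p l q : nat,
     [/\ [/\ (2 <= p)%N, (2 <= l)%N & (2 <= q)%N],
         (count_mem 2 [:: p; l; q] <= 1)%N
       & is_theta_graph p l q (induced X)]).

(** The vertex set of the graph written B{v} when [X] is the base of B. For
    [v \in X] the set [[set v]] is admissible, and the maximiser is unique. *)
Definition branch G (X : {set G}) (v : G) : {set G} :=
  [arg max_(S > [set v]
      | (S :&: X == [set v]) && connected_graph (induced S)) #|S|]%N.

Definition type_I G (X : {set G}) : Prop :=
  exists2 v : G, v \in X & matched_in (branch X v) v.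

Definition type_II G (X : {set G}) : Prop := ~ type_I X.

End Bicyclic.

(* Main.v *)
Require Import Defs.
From mathcomp Require Import all_boot all_order all_algebra all_fingroup.
From mathcomp Require Import polyrcf complex zify.
Set Implicit Arguments.
Unset Strict Implicit.
Unset Printing Implicit Defensive.
Import Order.TTheory GRing.Theory Num.Theory.

(** Both identities say that the adjacency matrix of [B], cut into blocks along a
    set [S] of vertices and its complement, is congruent to the block diagonal
    matrix with the same diagonal blocks.  Writing the matrix as
    [[A, b], [b^T, D]] with [A] the block of [S], this holds as soon as there is
    [Y] with [A *m Y = b] and [b^T *m Y = 0], because the Schur complement of [A]
    is then [D] itself; Sylvester's law of inertia concludes
    ([inertia_schur], [inertia_schur_graph]).

    The matrix [Y] comes from the weighted trees hanging at the base.  If [T] is a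
    weighted tree and [v] is matched in [T], then the unit vector at [v] is the
    image of a vector vanishing at [v] ([tree_matched]); if [v] is mismatched, then
    some kernel vector has value [1] at [v] ([tree_mismatched]).  Both follow from
    one induction that removes a leaf other than [v] together with its neighbour
    ([forest_solution]).  For Type I take [S = B{v}], the columns of [Y] being
    multiples of the vector given by [tree_matched]; for Type II take [S] to be the
    complement of the base, the column of [Y] at a base vertex [c] being the
    opposite of the kernel vector of the branch at [c], restricted to [S].

    The combinatorial part is done by counting edges.  A connected set can be
    built from any of its nonempty subsets by adding vertices one at a time, each
    with at least one new edge ([arcs_growth]).  Only two facts about the base [X]
    matter: it spans at least [#|X| + 1] edges, and each of its vertices has at
    least two neighbours in it ([base_degrees]).  As [B] spans exactly [#|B| + 1]
    edges, [B{v}] is a tree attached to the rest at [v] only ([branch_count],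
    [branch_edge]), and no component [K] of its complement spans more than [#|K|]
    edges ([component_count]). *)

(** * Inertia of real symmetric matrices *)

Section Spectral.
Variable R : rcfType.
Local Open Scope ring_scope.
Local Open Scope sesquilinear_scope.

(** The number of eigenvalues of [A] in [R] satisfying [Q], with multiplicity.
    [i_pos] and [i_neg] are instances of it. *)
Definition inertia (Q : pred R) n (A : 'M[R]_n) : nat :=
  (\sum_(a <- rootsR (char_poly A) | Q a) mup a (char_poly A))%N.

Lemma inertia_split (Q : pred R) n (A : 'M[R]_n) (s : seq R) :
  char_poly A = \prod_(a <- s) ('X - a%:P) -> inertia Q A = count Q s.
Proof.
rewrite /inertia => ->; set p := \prod_(a <- s) _.
have p0 : p != 0 by rewrite monic_neq0 ?monic_prod_XsubC.
have rootsE a : (a \in rootsR p) = (a \in s).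
  by have := roots_on_rootsR p0 a; rewrite !inE /= root_prod_XsubC.
under eq_bigr do rewrite mu_prod_XsubC -sum1_count.
rewrite -[RHS]sum1_count.
rewrite (exchange_big_dep Q) /=; last by move=> a b Qa /eqP ->.
rewrite big_seq_cond [RHS]big_seq_cond; apply: eq_bigr => b /andP[bs Qb].
rewrite (big_rem b) ?rootsE //= Qb eqxx /= big1_seq // => a /andP[/andP[_ /eqP ab]].
by rewrite -ab mem_rem_uniqF ?uniq_roots.
Qed.

(** Only these properties of the embedding [rc] of [R] into its complexification [C]
    are needed; keeping [C] abstract avoids computing in pairs. *)
Variables (C : numClosedFieldType) (rc : {rmorphism R -> C}).
Hypothesis rc_conj : forall x, (rc x)^* = rc x.
Hypothesis rc_gt0 : forall x, (0 < rc x) = (0 < x).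
Hypothesis rc_real : forall z : C, z \is Num.real -> exists x, z = rc x.
Local Notation "A ^rc" := (map_mx rc A) (at level 2).

(** The real symmetric matrix [A] is unitarily diagonalised over [C], with the
    real eigenvalues listed by [d]. *)
Definition spectral_dec n (A : 'M[R]_n) (d : 'rV[R]_n) : Prop :=
  exists2 P : 'M[C]_n, P \is unitarymx & A^rc = P^t* *m diag_mx d^rc *m P.

Lemma conj_real_mx m n (A : 'M[R]_(m, n)) : A^rc^t* = (A^T)^rc.
Proof. by apply/matrixP => i j; rewrite !mxE rc_conj. Qed.

Lemma spectral_dec_exists n (A : 'M[R]_n) : A^T = A -> exists d, spectral_dec A d.
Proof.
move=> symA.
have hermA : A^rc \is hermsymmx.
  by apply/is_hermitianmxP; rewrite expr0 scale1r conj_real_mx symA.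
have /orthomx_spectralP := hermitian_normalmx hermA.
have /mxOverP realD := hermitian_spectral_diag_real hermA.
rewrite invmx_unitary ?spectral_unitarymx // => AE.
have d_ex j : exists x, spectral_diag A^rc 0 j == rc x.
  by have [x ->] := rc_real (realD 0 j); exists x.
exists (\row_j xchoose (d_ex j)); exists (spectralmx A^rc).
  exact: spectral_unitarymx.
rewrite [LHS]AE; congr (_ *m diag_mx _ *m _); apply/matrixP => i j.
by rewrite !mxE ord1; apply/eqP/(xchooseP (d_ex j)).
Qed.

Lemma spectral_dec_opp n (A : 'M[R]_n) d :
  spectral_dec A d -> spectral_dec (- A) (- d).
Proof.
case=> P uP AE; exists P => //.
by rewrite !map_mxN /= AE linearN /= mulmxN mulNmx.
Qed.

Lemma spectral_dec_char_poly n (A : 'M[R]_n) d :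
  spectral_dec A d ->
  char_poly A = \prod_(a <- [seq d 0 i | i <- enum 'I_n]) ('X - a%:P).
Proof.
case=> P uP AE; apply: (map_poly_inj rc).
rewrite map_char_poly AE rmorph_prod big_map big_enum /=.
set D := diag_mx _.
have -> : char_poly (P^t* *m D *m P) = char_poly D.
  have PP : P^t* *m P = 1%:M by rewrite -invmx_unitary // mulVmx // unitarymx_unit.
  have PPX : map_mx polyC (P^t*) *m map_mx polyC P = 1%:M.
    by rewrite -map_mxM PP map_mx1.
  rewrite /char_poly /char_poly_mx !map_mxM.
  move: (map_mx polyC (P^t*)) (map_mx polyC P) PPX => L M LM.
  have XE : 'X%:M = L *m 'X%:M *m M by rewrite scalar_mxC -mulmxA LM mulmx1.
  rewrite {1}XE -mulmxBl -mulmxBr !det_mulmx mulrAC -[X in X * _]det_mulmx LM.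
  by rewrite det1 mul1r.
rewrite char_poly_trig ?diag_mx_is_trig //; apply: eq_bigr => i _.
by rewrite rmorphB /= map_polyX map_polyC /= !mxE eqxx mulr1n.
Qed.

Lemma inertia_spectral (Q : pred R) n (A : 'M[R]_n) d :
  spectral_dec A d -> inertia Q A = #|[pred i | Q (d 0 i)]|.
Proof.
move=> /spectral_dec_char_poly/(inertia_split Q) ->.
by rewrite count_map enumT cardE /enum_mem size_filter; apply: eq_count.
Qed.

Lemma diag_form n (w d : 'rV[C]_n) :
  (w *m diag_mx d *m w^t*) 0 0 = \sum_i d 0 i * `|w 0 i| ^+ 2.
Proof.
rewrite mxE; apply: eq_bigr => i _; rewrite mul_mx_diag !mxE normCK.
by rewrite mulrA [d 0 i * _]mulrC.
Qed.

(** Half of Sylvester's law: if the form of [A] is obtained from that of [B] by the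
    change of variables [S], then the span of the eigenvectors of [A] with positive
    eigenvalues injects into that of [B]. *)
Lemma sylvester_le n (A B S : 'M[R]_n) d e :
  A = S *m B *m S^T -> spectral_dec A d -> spectral_dec B e ->
  (#|[pred i | (0 < d 0 i)%R]| <= #|[pred i | (0 < e 0 i)%R]|)%N.
Proof.
move=> AE [P uP AP] [Q uQ BQ].
set k := #|_|; set k' := #|[pred i | 0 < e _ _]|.
pose f (i : 'I_k) : 'I_n := enum_val i.
pose g (i : 'I_k') : 'I_n := enum_val i.
pose U := rowsub f P.
(* [N] maps coordinates on the positive eigenvectors of [A] to coordinates on the
   positive eigenvectors of [B] *)
pose N : 'M_(k, k') := colsub g (U *m S^rc *m Q^t*).
suff /eqP <- : row_free N by apply: rank_leq_col.
apply/inj_row_free => v vN0.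
pose c := v *m (U *m S^rc *m Q^t*).
pose w := v *m rowsub f 1%:M.
have wE : w = v *m U *m P^t*.
  by rewrite /w /U -mulmxA mul_rowsub_mx; move/unitarymxP: uP => ->.
(* both sides are the value of the form of [A] at [v *m U] *)
have forms : c *m diag_mx e^rc *m c^t* = w *m diag_mx d^rc *m w^t*.
  transitivity (v *m U *m A^rc *m (v *m U)^t*).
    by rewrite AE !map_mxM BQ -conj_real_mx /c !(trmx_mul, map_mxM) !trmxCK !mulmxA.
  by rewrite AP wE !(trmx_mul, map_mxM) !trmxCK !mulmxA.
have wf i : w 0 (f i) = v 0 i.
  rewrite /w mxE (bigD1 i) //= !mxE eqxx mulr1 big1 ?addr0 // => j ji.
  by rewrite !mxE (inj_eq enum_val_inj) (negPf ji) mulr0.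
have w0 i : ~~ (0 < d 0 i) -> w 0 i = 0.
  move=> di; rewrite /w mxE big1 // => j _; rewrite !mxE.
  case: eqP => [fj|_]; last by rewrite mulr0.
  by have := enum_valP j; rewrite inE -/(f j) fj (negPf di).
have c0 i : 0 < e 0 i -> c 0 i = 0.
  move=> ei; have /rowP/(_ (enum_rank_in (ei : i \in [pred i | 0 < e 0 i]) i)) := vN0.
  rewrite /N mulmx_colsub [LHS]mxE [RHS]mxE -/c.
  by rewrite /g enum_rankK_in.
have nnegw i : true -> 0 <= d^rc 0 i * `|w 0 i| ^+ 2.
  move=> _; case: (boolP (0 < d 0 i)) => di; last by rewrite w0 // normr0 expr0n mulr0.
  by rewrite mulr_ge0 ?exprn_ge0 ?normr_ge0 // mxE ltW ?rc_gt0.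
have sum0 : \sum_i d^rc 0 i * `|w 0 i| ^+ 2 = 0.
  apply/eqP; rewrite eq_le sumr_ge0 // andbT.
  rewrite -diag_form -forms diag_form sumr_le0 // => i _.
  case: (boolP (0 < e 0 i)) => ei; first by rewrite c0 // normr0 expr0n mulr0.
  rewrite mulr_le0_ge0 ?exprn_ge0 ?normr_ge0 // mxE -oppr_ge0 -rmorphN.
  move: ei; rewrite -leNgt le_eqVlt => /orP[/eqP->|ei]; first by rewrite oppr0 rmorph0.
  by rewrite ltW // rc_gt0 oppr_gt0.
apply/rowP => i; rewrite mxE -wf.
have /eqP := psumr_eq0P nnegw sum0 (isT : xpredT (f i)).
rewrite mulf_eq0 sqrf_eq0 normr_eq0 => /orP[|/eqP//].
by have := enum_valP i; rewrite inE -rc_gt0 mxE => /gt_eqF ->.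
Qed.

Lemma sylvester n (A B S : 'M[R]_n) :
  S \in unitmx -> B^T = B -> A = S *m B *m S^T ->
  inertia (fun x => 0 < x) A = inertia (fun x => 0 < x) B /\
  inertia (fun x => x < 0) A = inertia (fun x => x < 0) B.
Proof.
move=> uS symB AE.
have BE : B = invmx S *m A *m (invmx S)^T.
  by rewrite AE !mulmxA mulVmx // mul1mx -mulmxA trmx_inv mulmxV ?unitmx_tr // mulmx1.
have symA : A^T = A by rewrite AE !trmx_mul symB trmxK mulmxA.
have [d dA] := spectral_dec_exists symA; have [e eB] := spectral_dec_exists symB.
have negE n' (c : 'rV[R]_n') :
    #|[pred i | c 0 i < 0]| = #|[pred i | (0 < (- c) 0 i)]|.
  by apply: eq_card => i; rewrite !inE mxE oppr_gt0.
have AE' : - A = S *m (- B) *m S^T by rewrite AE mulmxN mulNmx.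
have BE' : - B = invmx S *m (- A) *m (invmx S)^T by rewrite {1}BE mulmxN mulNmx.
have dA' := spectral_dec_opp dA; have eB' := spectral_dec_opp eB.
rewrite !(inertia_spectral _ dA) !(inertia_spectral _ eB) !negE.
split; apply/eqP; rewrite eqn_leq.
  by rewrite (sylvester_le AE dA eB) (sylvester_le BE eB dA).
by rewrite (sylvester_le AE' dA' eB') (sylvester_le BE' eB' dA').
Qed.

Lemma inertia_diag_block (Q : pred R) m p (A : 'M[R]_m) (D : 'M[R]_p) :
  A^T = A -> D^T = D ->
  inertia Q (block_mx A 0 0 D) = (inertia Q A + inertia Q D)%N.
Proof.
move=> /spectral_dec_exists[d dA] /spectral_dec_exists[e eD].
have cA := spectral_dec_char_poly dA; have cD := spectral_dec_char_poly eD.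
rewrite (inertia_split Q cA) (inertia_split Q cD) -count_cat.
apply: inertia_split; rewrite big_cat -cA -cD.
rewrite /char_poly /char_poly_mx map_block_mx !map_mx0 (scalar_mx_block _ _ 'X).
by rewrite opp_block_mx add_block_mx !oppr0 !addr0 det_ublock.
Qed.

End Spectral.

Section Inertia.
Variable R : rcfType.
Local Open Scope ring_scope.

(** The complexification of [R] carries the conjugation used by the spectral theorem. *)
Lemma complexification :
  exists (C : numClosedFieldType) (rc : {rmorphism R -> C}),
    [/\ forall x, (rc x)^* = rc x, forall x, (0 < rc x) = (0 < x)
      & forall z, z \is Num.real -> exists x, z = rc x].
Proof.
exists R[i]%C, (real_complex R); split=> [x|x|z /complex_realP//].
  exact: conjc_real.
by rewrite ltcR.
Qed.

(** When the off-diagonal block [b] factors as [A *m Y] with [b^T *m Y = 0], the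
    Schur complement of [A] in the block matrix is [D] itself. *)
Lemma inertia_schur m p (A : 'M[R]_m) (D : 'M[R]_p) (b Y : 'M[R]_(m, p)) :
  A^T = A -> D^T = D -> A *m Y = b -> b^T *m Y = 0 ->
  let M := block_mx A b b^T D in
  inertia (fun x => 0 < x) M
    = (inertia (fun x => (0 < x)%R) A + inertia (fun x => (0 < x)%R) D)%N /\
  inertia (fun x => x < 0) M
    = (inertia (fun x => (x < 0)%R) A + inertia (fun x => (x < 0)%R) D)%N.
Proof.
move=> symA symD AY bY M.
have [C [rc [rc_conj rc_gt0 rc_real]]] := complexification.
pose L : 'M[R]_(m + p) := block_mx 1%:M 0 Y^T 1%:M.
pose N : 'M[R]_(m + p) := block_mx A 0 0 D.
have YA : Y^T *m A = b^T by rewrite -AY trmx_mul symA.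
have ME : M = L *m N *m L^T.
  rewrite /L /N tr_block_mx !trmx1 trmx0 trmxK !mulmx_block.
  by rewrite !(mul1mx, mulmx1, mul0mx, mulmx0, addr0, add0r) YA AY bY add0r.
have uL : L \in unitmx by rewrite unitmxE det_lblock !det1 mulr1 unitr1.
have symN : N^T = N by rewrite tr_block_mx symA symD !trmx0.
have [-> ->] := sylvester rc_conj rc_gt0 rc_real uL symN ME.
by rewrite !(inertia_diag_block rc_conj rc_real).
Qed.

(** Conjugating by a permutation does not change the characteristic polynomial; the
    two dimensions need only be provably equal. *)
Lemma inertia_reindex (Q : pred R) n m (A : 'M[R]_n) (B : 'M[R]_m) (f : 'I_m -> 'I_n) :
  injective f -> m = n -> (forall i j, B i j = A (f i) (f j)) ->
  inertia Q B = inertia Q A.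
Proof.
move=> injf mn; move: mn f injf A B => -> f injf A B BE.
rewrite /inertia; suff -> : char_poly B = char_poly A by [].
rewrite /char_poly; pose s := perm injf.
have -> : char_poly_mx B = row_perm s (col_perm s (char_poly_mx A)).
  by apply/matrixP => i j; rewrite !mxE BE !permE (inj_eq injf).
rewrite row_permE col_permE !det_mulmx !det_perm odd_permV mulrCA.
by rewrite -signr_addb addbb mulr1.
Qed.

(** The weight of the pair [x, y], zero off the edges. *)
Definition adj (G : wgraph R) (x y : G) : R := if edge x y then wt x y else 0.

Lemma adj_sym (G : wgraph R) (x y : G) : adj x y = adj y x.
Proof. by rewrite /adj edge_sym wt_sym. Qed.

Lemma adjacency_sym (G : wgraph R) : (adjacency G)^T = adjacency G.
Proof. by apply/matrixP => i j; rewrite !mxE edge_sym wt_sym. Qed.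

Lemma sum_induced (V : nmodType) (G : wgraph R) (S : {set G}) (F : G -> V) :
  \sum_(x : induced S) F (val x) = \sum_(x in S) F x.
Proof.
rewrite [RHS](reindex_omap (val : induced S -> G) insub) => [|x xS]; last by rewrite insubT.
by apply: eq_bigl => x; rewrite (valP x) valK eqxx.
Qed.

(** [inertia_schur] for the adjacency matrix cut along [S].  Only the values [Y t c]
    with [t] in [S] and [c] outside [S] matter. *)
Lemma inertia_schur_graph (G : wgraph R) (S : {set G}) (Y : G -> G -> R) :
  (forall t c, t \in S -> c \notin S -> \sum_(u in S) adj t u * Y u c = adj t c) ->
  (forall c c', c \notin S -> c' \notin S -> \sum_(u in S) adj c u * Y u c' = 0) ->
  i_pos G = (i_pos (induced S) + i_pos (delete S))%N /\
  i_neg G = (i_neg (induced S) + i_neg (delete S))%N.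
Proof.
move=> AY bY; set H := induced S; set K := delete S.
have valH (i : 'I_#|H|) : val (enum_val i) \in S := valP (enum_val i : H).
have valK (i : 'I_#|K|) : val (enum_val i) \notin S.
  by have := valP (enum_val i : K); rewrite /= inE.
have sumH (F : G -> R) : \sum_(k < #|H|) F (val (enum_val k)) = \sum_(u in S) F u.
  rewrite -(big_enum_val (fun x : H => F (val x))) /=.
  exact: sum_induced.
pose f (k : 'I_(#|H| + #|K|)) : 'I_#|G| :=
  match split k with
  | inl i => enum_rank (val (enum_val i))
  | inr j => enum_rank (val (enum_val j))
  end.
have fl i : enum_val (f (lshift _ i)) = val (enum_val i : H).
  by rewrite /f (unsplitK (inl i)) enum_rankK.
have fr i : enum_val (f (rshift _ i)) = val (enum_val i : K).
  by rewrite /f (unsplitK (inr i)) enum_rankK.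
have injf : injective f.
  move=> k1 k2 /(congr1 enum_val).
  case: (split_ordP k1) => i ->; case: (split_ordP k2) => j ->; rewrite ?fl ?fr.
  - by move=> /val_inj/enum_val_inj ->.
  - by move=> ij; have := valH i; rewrite ij (negPf (valK j)).
  - by move=> ij; have := valH j; rewrite -ij (negPf (valK i)).
  - by move=> /val_inj/enum_val_inj ->.
have cardG : (#|H| + #|K| = #|G|)%N.
  by rewrite !card_sig -(cardC (mem S)); congr (_ + _)%N; apply: eq_card => x; rewrite !inE.
pose b : 'M[R]_(#|H|, #|K|) := \matrix_(i, j) adj (val (enum_val i)) (val (enum_val j)).
pose Z : 'M[R]_(#|H|, #|K|) := \matrix_(i, j) Y (val (enum_val i)) (val (enum_val j)).
have AZ : adjacency H *m Z = b.
  apply/matrixP => r c; rewrite !mxE -AY ?valH ?valK // -sumH.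
  by apply: eq_bigr => k _; rewrite [adjacency H r k]mxE [Z k c]mxE.
have bZ : b^T *m Z = 0.
  apply/matrixP => i j; rewrite [LHS]mxE [RHS]mxE.
  rewrite -[RHS](bY (val (enum_val i)) (val (enum_val j))) ?valK // -sumH.
  by apply: eq_bigr => k _; rewrite [Z k j]mxE [b^T i k]mxE [b k i]mxE adj_sym.
have [] := inertia_schur (adjacency_sym H) (adjacency_sym K) AZ bZ.
have ME i j : block_mx (adjacency H) b b^T (adjacency K) i j = adjacency G (f i) (f j).
  case: (split_ordP i) => i' ->; case: (split_ordP j) => j' ->.
  - by rewrite block_mxEul !mxE !fl.
  - by rewrite block_mxEur !mxE fl fr.
  - by rewrite block_mxEdl !mxE fl fr adj_sym.
  - by rewrite block_mxEdr !mxE !fr.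
by rewrite !(inertia_reindex _ injf cardG ME).
Qed.

End Inertia.

(** * Counting arcs *)

Section Arcs.
Variables (R : rcfType) (G : wgraph R).
Implicit Types (S T A : {set G}) (x y v : G).

(** The number of neighbours of [x] in [S]. *)
Definition deg S x : nat := \sum_(y in S) edge x y.

(** The number of ordered pairs of adjacent vertices of [S], that is, twice the
    number of edges inside [S]. *)
Definition arcs S : nat := \sum_(x in S) deg S x.

(** The number of adjacent pairs with first vertex in [S] and second vertex in [T]. *)
Definition cross S T : nat := \sum_(x in S) deg T x.

Lemma crossC S T : cross S T = cross T S.
Proof.
rewrite /cross /deg exchange_big /=; apply: eq_bigr => x _.
by apply: eq_bigr => y _; rewrite edge_sym.
Qed.

Lemma degU S T x : [disjoint S & T] -> deg (S :|: T) x = deg S x + deg T x.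
Proof. by move=> dST; rewrite /deg -bigU //=; apply: eq_bigl => y; rewrite !inE. Qed.

Lemma arcsU S T : [disjoint S & T] ->
  arcs (S :|: T) = arcs S + arcs T + 2 * cross S T.
Proof.
move=> dST; rewrite /arcs (eq_bigl [predU S & T]); last by move=> x; rewrite !inE.
rewrite bigU //= !(eq_bigr _ (fun x _ => degU x dST)) !big_split /=.
by rewrite -/(cross S T) -/(cross T S) (crossC T S); lia.
Qed.

Lemma degE S x : deg S x = #|[set y in S | edge x y]|.
Proof.
rewrite /deg -sum1_card big_mkcond [RHS]big_mkcond /=; apply: eq_bigr => y _.
by rewrite !inE; case: (y \in S) => //=; case: (edge x y).
Qed.

Lemma deg_gt0P S x : reflect (exists2 y, y \in S & edge x y) (0 < deg S x).
Proof.
rewrite degE card_gt0; apply: (iffP (set0Pn _)) => [[y]|[y yS xy]].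
  by rewrite !inE => /andP[]; exists y.
by exists y; rewrite !inE yS.
Qed.

Lemma deg0P S x : reflect (forall y, y \in S -> ~~ edge x y) (deg S x == 0).
Proof.
rewrite -leqn0 leqNgt; apply: (iffP idP) => [/deg_gt0P h y yS|h].
  by apply/negP => xy; apply: h; exists y.
by apply/negP => /deg_gt0P[y yS]; rewrite (negPf (h y yS)).
Qed.

Lemma deg_sub S T x : S \subset T -> deg S x <= deg T x.
Proof.
move=> sST; rewrite !degE subset_leq_card //; apply/subsetP => y.
by rewrite !inE => /andP[/(subsetP sST) -> ->].
Qed.

(** Distinct neighbours of [x] in [S] bound its degree from below. *)
Lemma leq_deg S x (s : seq G) :
  uniq s -> (forall y, y \in s -> (y \in S) && edge x y) -> size s <= deg S x.
Proof.
move=> us sP; rewrite degE -(card_uniqP us) subset_leq_card //.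
by apply/subsetP => y /sP; rewrite inE.
Qed.

Lemma arcs1 x : arcs [set x] = 0.
Proof. by rewrite /arcs big_set1 /deg big_set1 edge_irr. Qed.

Lemma arcsU1 S y : y \notin S -> arcs (y |: S) = arcs S + 2 * deg S y.
Proof.
move=> yS; rewrite arcsU ?disjoints1 // arcs1 /cross big_set1; lia.
Qed.

Lemma arcs_deg_geq S k : (forall x, x \in S -> k <= deg S x) -> k * #|S| <= arcs S.
Proof.
move=> h; rewrite /arcs -sum1_card big_distrr /=; apply: leq_sum => x xS.
by rewrite muln1 h.
Qed.

(** Each edge is the image of exactly two arcs. *)
Lemma arcs_edges : arcs [set: G] = 2 * #|edges G|.
Proof.
have -> : arcs [set: G] = #|[set p : G * G | edge p.1 p.2]|.
  rewrite /arcs /deg -sum1_card (eq_bigl xpredT) => [|x]; last by rewrite inE.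
  under eq_bigr do under eq_bigl do rewrite inE.
  rewrite pair_bigA [RHS]big_mkcond /=; apply: eq_bigr => p _.
  by rewrite inE; case: edge.
pose f (p : G * G) := [set p.1; p.2].
rewrite -sum1_card (partition_big_imset f) /=.
rewrite (_ : f @: _ = edges G); last by apply: eq_imset => p.
rewrite -sum1_card big_distrr /=; apply: eq_bigr => E /imsetP[[x y]] /=.
rewrite inE /= => xy ->; rewrite muln1.
have nxy : x != y by apply: contraTneq xy => ->; rewrite edge_irr.
rewrite (eq_bigl (mem [set (x, y); (y, x)])) => [|[a b]].
  by rewrite sum1_card cards2 xpair_eqE (negPf nxy).
rewrite !inE /f /= !xpair_eqE; apply/andP/orP => [[ab /eqP E2]|].
  have nab : a != b by apply: contraTneq ab => ->; rewrite edge_irr.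
  have := set21 a b; have := set22 a b; rewrite E2 !inE.
  move=> /orP[]/eqP bE /orP[]/eqP aE; subst a b; rewrite ?eqxx in nab *; by [|left|right].
by case=> /andP[/eqP -> /eqP ->]; split; rewrite // 1?edge_sym // setUC.
Qed.

End Arcs.

Section InducedArcs.
Variables (R : rcfType) (G : wgraph R) (S : {set G}).

Lemma deg_induced (K : {set induced S}) (z : induced S) :
  deg K z = deg [set val u | u in K] (val z).
Proof. by rewrite /deg big_imset //= => x y _ _; apply: val_inj. Qed.

Lemma arcs_induced (K : {set induced S}) : arcs K = arcs [set val u | u in K].
Proof.
rewrite /arcs big_imset /=; last by move=> x y _ _; apply: val_inj.
by apply: eq_bigr => z _; apply: deg_induced.
Qed.

Lemma imset_valT : [set val u | u in [set: induced S]] = S.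
Proof.
apply/setP => x; apply/imsetP/idP => [[u _ ->]|xS]; first exact: valP u.
by exists (Sub x xS) => //; rewrite inE.
Qed.

Lemma card_induced : #|induced S| = #|S|.
Proof. by rewrite card_sig; apply: eq_card => x. Qed.

Lemma arcs_edges_induced : arcs S = 2 * #|edges (induced S)|.
Proof. by rewrite -arcs_edges arcs_induced imset_valT. Qed.

End InducedArcs.

Section Connected.
Variables (R : rcfType) (G : wgraph R).
Implicit Types (S T A : {set G}) (x y v : G).

(** Connectedness of the subgraph induced by [S]: it is nonempty and has no proper
    nonempty part closed under adjacency. *)
Definition conn S : Prop :=
  S != set0 /\ forall A, A \subset S -> A != set0 ->
    (forall x y, x \in A -> y \in S -> edge x y -> y \in A) -> A = S.

Lemma conn1 x : conn [set x].
Proof.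
split=> [|A sA A0 _]; first by rewrite -cards_eq0 cards1.
by move: sA; rewrite subset1 (negPf A0) orbF => /eqP.
Qed.

Lemma connU1 T t y : conn T -> t \in T -> edge t y -> conn (y |: T).
Proof.
move=> [T0 cT] tT ty; split=> [|A sA /set0Pn[a aA] clA].
  by apply/set0Pn; exists y; rewrite setU11.
have tyA : (t \in A) = (y \in A).
  by apply/idP/idP => h; [apply: (clA t)|apply: (clA y)]; rewrite ?inE ?eqxx ?tT ?orbT // edge_sym.
have sTA : A :&: T != set0 -> T \subset A.
  move=> AT0; apply/setIidPr/cT => //; first exact: subsetIr.
  move=> u w; rewrite !inE => /andP[uA _] wT uw; rewrite wT andbT.
  by apply: (clA u) => //; rewrite inE wT orbT.
have yA : y \in A.
  have := subsetP sA a aA; rewrite !inE => /orP[/eqP <- //|aT].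
  by rewrite -tyA; apply: (subsetP (sTA _)) => //; apply/set0Pn; exists a; rewrite inE aA.
apply/eqP; rewrite eqEsubset sA subUset sub1set yA /= sTA //.
by apply/set0Pn; exists t; rewrite inE tyA yA.
Qed.

(** A connected set [T] is reached from a nonempty subset [S] by adding vertices one
    at a time, each adjacent to an earlier one: every step adds at least one edge,
    that is, two arcs. *)
Lemma arcs_growth S T : conn T -> S \subset T -> S != set0 ->
  arcs S + 2 * #|T| <= arcs T + 2 * #|S|.
Proof.
move=> cT; have [k] := ubnP (#|T| - #|S|); elim: k S => // k IH S leS sST S0.
have [-> //|neST] := eqVneq S T.
have [y /andP[yT yS] degy] : exists2 y, (y \in T) && (y \notin S) & 0 < deg S y.
  apply/exists_inP; apply: contraR neST; rewrite negb_exists_in => /forall_inP h.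
  apply/eqP/cT.2 => // u w uS wT uw; apply/negPn/negP => wS.
  have /negP[] : ~~ (0 < deg S w) by apply: h; rewrite wT.
  by apply/deg_gt0P; exists u; rewrite // edge_sym.
have sSyT : y |: S \subset T by rewrite subUset sub1set yT.
have := subset_leq_card sSyT; rewrite cardsU1 yS => leyS.
have := IH (y |: S); rewrite arcsU1 // cardsU1 yS.
move=> /(_ _ sSyT) IH'; have {}IH' := IH' ltac:(lia) ltac:(apply/set0Pn; exists y; rewrite setU11 //).
lia.
Qed.

Lemma arcs_conn T : conn T -> 2 * #|T| <= arcs T + 2.
Proof.
move=> cT; have /set0Pn[x xT] := cT.1.
have := arcs_growth cT (S := [set x]); rewrite sub1set xT arcs1 cards1.
by move=> /(_ isT) h; have := h ltac:(by rewrite -cards_eq0 cards1); lia.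
Qed.

Lemma connected_graphP : reflect (conn [set: G]) (connected_graph G).
Proof.
apply: (iffP andP) => [[G0 /forallP cG]|[/set0Pn[x0 _] cG]]; split.
- by rewrite -card_gt0 cardsT.
- move=> A _ /set0Pn[a aA] clA; apply/eqP; rewrite -subTset; apply/subsetP => y _.
  have clo : closed (@edge R G) (mem A).
    apply: intro_closed; first exact/sym_connect_sym/edge_sym.
    by move=> u w uw uA; apply: (clA u) => //; rewrite inE.
  by have /forallP/(_ y)/(closed_connect clo) := cG a; rewrite /= aA => <-.
- by apply/card_gt0P; exists x0.
apply/forallP => x; apply/forallP => y.
suff /setP/(_ y) : [set z | connect (@edge R G) x z] = [set: G] by rewrite !inE.
apply: cG => //; first by apply/set0Pn; exists x; rewrite inE connect0.
by move=> u w; rewrite !inE => xu _ uw; apply: connect_trans xu (connect1 uw).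
Qed.

End Connected.

Lemma conn_induced (R : rcfType) (G : wgraph R) (S : {set G}) (K : {set induced S}) :
  conn K <-> conn [set val u | u in K].
Proof.
have valI (A : {set induced S}) : (val @: A == set0) = (A == set0) by rewrite imset_eq0.
split=> -[K0 cK]; split; rewrite ?valI // in K0 *; move=> A sA A0 clA.
  pose A' := [set u : induced S | val u \in A].
  have AE : A = [set val u | u in A'].
    apply/setP => x; apply/idP/imsetP => [xA|[u uA ->]]; last by rewrite inE in uA.
    have /imsetP[u uK xE] := subsetP sA x xA.
    by exists u; rewrite // inE -xE.
  rewrite AE; suff -> : A' = K by []; apply: cK.
  - apply/subsetP => u; rewrite inE => /(subsetP sA)/imsetP[w wK /val_inj ->] //.
  - by rewrite -valI -AE.
  - by move=> x y; rewrite !inE => xA yK xy; apply: (clA (val x)) => //; apply: imset_f.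
apply: (imset_inj val_inj); apply: cK; rewrite ?valI ?imsetS //.
move=> _ _ /imsetP[x xA ->] /imsetP[y yK ->] xy; apply: imset_f.
exact: (clA x).
Qed.

Lemma connected_induced (R : rcfType) (G : wgraph R) (S : {set G}) :
  reflect (conn S) (connected_graph (induced S)).
Proof.
have := conn_induced [set: induced S]; rewrite imset_valT => -[h1 h2].
by apply: (iffP (connected_graphP _)).
Qed.

(** * Matchings and linear systems on forests *)

Section Matchings.
Variables (R : rcfType) (G : wgraph R).
Implicit Types (S A : {set G}) (M : {set {set G}}) (x y p v : G).

(** The matching number of the subgraph induced by [S]. *)
Definition nu S : nat :=
  \max_(M : {set {set G}} | is_matching M && (cover M \subset S)) #|M|.

Lemma nu_geq S M : is_matching M -> cover M \subset S -> #|M| <= nu S.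
Proof.
move=> mM cM; apply: (leq_bigmax_cond (F := fun M : {set {set G}} => #|M|)).
by rewrite mM.
Qed.

Lemma nu_witness S : exists M, [/\ is_matching M, cover M \subset S & #|M| = nu S].
Proof.
have P0 : is_matching (set0 : {set {set G}}) && (cover (set0 : {set {set G}}) \subset S).
  by rewrite /is_matching sub0set /cover big_set0 sub0set andbT; apply/trivIsetP => E; rewrite inE.
rewrite /nu (bigop.bigmax_eq_arg set0) //.
by case: arg_maxnP => // M /andP[mM cM] _; exists M.
Qed.

Lemma edgesP x E : E \in edges G -> x \in E -> exists2 y, edge x y & E = [set x; y].
Proof.
case/imsetP => -[a b]; rewrite inE /= => ab -> /set2P[->|->]; first by exists b.
by exists a; rewrite 1?edge_sym // setUC.
Qed.

Lemma matching_edge M E : is_matching M -> E \in M -> E \in edges G.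
Proof. by case/andP => /subsetP h _; apply: h. Qed.

Lemma matching_sub M (N : {set {set G}}) : is_matching M -> N \subset M -> is_matching N.
Proof.
by case/andP => eM tM sN; rewrite /is_matching (subset_trans sN eM) (trivIsetS sN tM).
Qed.

Lemma nu_isolated S x : deg S x = 0 -> nu (S :\ x) = nu S.
Proof.
move/eqP/deg0P => dx; apply: eq_bigl => M; case: (boolP (is_matching M)) => //= mM.
rewrite subsetD1; case: (boolP (cover M \subset S)) => //= cM.
apply/negP => /bigcupP[E EM xE].
have [y xy EE] := edgesP (matching_edge mM EM) xE.
have /dx : y \in S by apply/(subsetP cM)/bigcupP; exists E; rewrite // EE set22.
by rewrite xy.
Qed.

(** Some maximum matching uses the edge at a leaf. *)
Lemma nu_leaf S x p : x \in S -> p \in S -> edge x p ->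
  (forall y, y \in S -> edge x y -> y = p) -> nu S = (nu (S :\ x :\ p)).+1.
Proof.
move=> xS pS xp lx; apply/eqP; rewrite eqn_leq; apply/andP; split.
  have [M [mM cM <-]] := nu_witness S.
  pose N := [set E in M | p \notin E].
  have sNM : N \subset M by apply/subsetP => E; rewrite inE => /andP[].
  have mN := matching_sub mM sNM.
  have cN : cover N \subset S :\ x :\ p.
    have cNS : cover N \subset S.
      by apply/subsetP => u /bigcupP[E /(subsetP sNM) EM uE]; apply/(subsetP cM)/bigcupP; exists E.
    rewrite !subsetD1 cNS /=; apply/andP; split; apply/negP => /bigcupP[E].
      rewrite inE => /andP[EM pE] xE.
      have [y xy EE] := edgesP (matching_edge mM EM) xE.
      have yS : y \in S by apply/(subsetP cM)/bigcupP; exists E; rewrite // EE set22.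
      by move: pE; rewrite EE (lx y yS xy) set22.
    by rewrite inE => /andP[_ /negP].
  apply: leq_trans (_ : #|N|.+1 <= _); last by rewrite ltnS nu_geq.
  have [/existsP[E /andP[EM pE]]|/existsPn noE] := boolP [exists E, (E \in M) && (p \in E)].
    rewrite (cardsD1 E M) EM add1n ltnS subset_leq_card //.
    apply/subsetP => F; rewrite !inE => /andP[FE FM]; rewrite FM /=.
    have /andP[_ /trivIsetP tM] := mM.
    by have := disjointFr (tM F E FM EM FE); move=> /(_ p) h; apply: contraTN pE => /h ->.
  rewrite ltnW // ltnS subset_leq_card //; apply/subsetP => E EM; rewrite inE EM /=.
  by have := noE E; rewrite EM.
have [M [mM cM <-]] := nu_witness (S :\ x :\ p).
have xM : x \notin cover M.
  by apply/negP => /(subsetP cM); rewrite !inE eqxx andbF.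
have pM : p \notin cover M by apply/negP => /(subsetP cM); rewrite !inE eqxx.
have eM : [set x; p] \notin M.
  by apply: contra xM => h; apply/bigcupP; exists [set x; p]; rewrite ?set21.
have cM' : cover ([set x; p] |: M) = [set x; p] :|: cover M.
  by rewrite /cover bigcup_setU big_set1.
suff <- : #|[set x; p] |: M| = #|M|.+1.
  apply: nu_geq; last first.
    rewrite cM' subUset (subset_trans cM) ?andbT.
      by apply/subsetP => u /set2P[] ->.
    by apply/subsetP => u; rewrite !inE => /and3P[].
  have /andP[sM tM] := mM.
  rewrite /is_matching subUset sub1set sM andbT; apply/andP; split.
    by apply/imsetP; exists (x, p); rewrite ?inE.
  have M0 : set0 \notin M.
    by apply/negP => /(subsetP sM)/imsetP[e _ /setP/(_ e.1)]; rewrite !inE eqxx.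
  suff dM : {in M, forall E : {set G}, [disjoint [set x; p] & E]} by have [] := trivIsetU1 dM tM M0.
  move=> E EM; rewrite disjoint_sym disjoints_subset; apply/subsetP => u uE.
  rewrite !inE negb_or; apply/andP; split.
    by apply: contraNneq xM => <-; apply/bigcupP; exists E.
  by apply: contraNneq pM => <-; apply/bigcupP; exists E.
by rewrite cardsU1 eM.
Qed.

Lemma subC1 A v : (A \subset [set~ v]) = (v \notin A).
Proof. by rewrite -setTD subsetD1 subsetT. Qed.

Lemma mismatchedE v : mismatched v = (nu [set~ v] == nu [set: G]).
Proof.
apply/existsP/eqP => [[M /andP[/andP[mM /forallP maxM] vM]]|E].
  have sM : #|M| = nu [set: G].
    apply/eqP; rewrite eqn_leq nu_geq ?subsetT //=.
    by have [N [mN _ <-]] := nu_witness [set: G]; have := maxM N; rewrite mN.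
  apply/eqP; rewrite eqn_leq -{2}sM nu_geq // ?andbT; last by rewrite subC1.
  have [N [mN _ <-]] := nu_witness [set~ v].
  by rewrite nu_geq ?subsetT.
have [M [mM cM MM]] := nu_witness [set~ v].
exists M; rewrite -subC1 cM andbT /is_maximum_matching mM /=.
by apply/forallP => N; apply/implyP => mN; rewrite MM E nu_geq ?subsetT.
Qed.

End Matchings.

Section Forests.
Variables (R : rcfType) (G : wgraph R).
Implicit Types (S A : {set G}) (x y p v : G) (z F : G -> R).

(** No cycle is contained in [S], stated as an edge bound on its subsets. *)
Definition forest S : Prop := forall A, A \subset S -> A != set0 -> arcs A < 2 * #|A|.

Lemma forest_sub S A : forest S -> A \subset S -> forest A.
Proof. by move=> fS sA C sC; apply: fS; apply: subset_trans sA. Qed.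

Lemma tree_forest : is_tree G -> forest [set: G].
Proof.
case/andP => /connected_graphP cG /eqP eG A sA A0.
by have := arcs_growth cG sA A0; rewrite arcs_edges cardsT; lia.
Qed.

Lemma arcs_even S : ~~ odd (arcs S).
Proof. by rewrite arcs_edges_induced oddM. Qed.

(** If all the vertices of [S] but one have two neighbours in [S] and the
    exceptional one has a neighbour, then [S] spans at least [#|S|] edges. *)
Lemma arcs_geq_except S v : v \in S -> 0 < deg S v ->
  (forall x, x \in S -> x != v -> 1 < deg S x) -> 2 * #|S| <= arcs S.
Proof.
move=> vS dv h.
have : 2 * #|S :\ v| + 1 <= arcs S.
  rewrite /arcs (big_setD1 v) //= addnC leq_add // -sum1_card big_distrr /=.
  by apply: leq_sum => x; rewrite !inE muln1 => /andP[xv xS]; apply: h.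
by have := arcs_even S; rewrite (cardsD1 v S) vS; lia.
Qed.

Lemma forest_leaf S v : forest S -> v \in S -> S != [set v] ->
  exists2 x, x \in S :\ v & deg S x <= 1.
Proof.
move=> fS vS nS; apply/exists_inP; apply: contraT; rewrite negb_exists_in => /forall_inP h.
have {}h x : x \in S -> x != v -> 1 < deg S x.
  by move=> xS xv; rewrite ltnNge h // !inE xv.
have S0 : S != set0 by apply/set0Pn; exists v.
have A0 : S :\ v != set0.
  apply: contra nS => /eqP SE; apply/eqP/setP => u; move/setP/(_ u): SE; rewrite !inE.
  by case: eqP => [->|] //= _ ->.
have [dv|dv] := posnP (deg S v); last first.
  by have := arcs_geq_except vS dv h; have := fS S (subxx _) S0; lia.
have dA : deg (S :\ v) v = 0 by apply/eqP; rewrite -leqn0 -dv deg_sub // subD1set.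
have := fS (S :\ v) (subD1set _ _) A0; rewrite ltnNge arcs_deg_geq // => x.
rewrite !inE => /andP[xv xS]; have := h x xS xv.
rewrite -{1}(setD1K vS) degU ?disjoints1 ?setD11 //.
by rewrite {1}/deg big_set1; move/eqP/deg0P: dA => /(_ x); rewrite !inE xv xS edge_sym => /(_ isT)/negPf ->.
Qed.

Local Open Scope ring_scope.

(** [z] is supported on [S] and solves the linear system of the subgraph induced
    by [S] with right-hand side [F]. *)
Definition solves S z F : Prop :=
  (forall u, u \notin S -> z u = 0) /\
  (forall t, t \in S -> \sum_u adj t u * z u = F t).

Lemma solves_isolated S x z F : x \in S -> deg S x = 0%N -> F x = 0 ->
  solves (S :\ x) z F -> solves S z F.
Proof.
move=> xS /eqP/deg0P dx Fx [supp eqn]; split=> [u uS|t tS].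
  by apply: supp; rewrite !inE (negPf uS) andbF.
have [->|tx] := eqVneq t x; last by apply: eqn; rewrite !inE tx.
rewrite Fx big1 // => u _; have [uS|uS] := boolP (u \in S).
  by rewrite /adj (negPf (dx u uS)) mul0r.
by rewrite supp ?mulr0 // !inE (negPf uS) andbF.
Qed.

(** A solution away from a leaf [x] and its neighbour [p] extends: the value at
    [p] is zero, and the value at [x] is determined by the equation at [p]. *)
Lemma solves_leaf S x p z F : x \in S -> p \in S -> edge x p ->
  (forall y, y \in S -> edge x y -> y = p) -> F x = 0 -> F p = 0 ->
  solves (S :\ x :\ p) z F ->
  exists2 z', solves S z' F & forall u, u != x -> z' u = z u.
Proof.
move=> xS pS xp lx Fx Fp [supp eqn].
have px0 : adj p x != 0 by rewrite /adj edge_sym xp gt_eqF // wt_gt0 // edge_sym.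
pose c := - (\sum_u adj p u * z u) / adj p x.
pose z' u := z u + c * (u == x)%:R.
have sumE t : \sum_u adj t u * z' u = \sum_u adj t u * z u + c * adj t x.
  transitivity (\sum_u (adj t u * z u + adj t u * (c * (u == x)%:R))).
    by apply: eq_bigr => u _; rewrite mulrDr.
  rewrite big_split /=; congr (_ + _); rewrite (bigD1 x) //= eqxx mulr1 mulrC.
  by rewrite big1 ?addr0 // => u /negPf ->; rewrite !mulr0.
exists z'; last by move=> u /negPf ux; rewrite /z' ux mulr0 addr0.
split=> [u uS|t tS].
  rewrite /z' supp ?inE ?(negPf uS) ?andbF // add0r.
  by case: eqP => [ux|_]; rewrite ?mulr0 //; rewrite ux xS in uS.
rewrite sumE; have [->|tp] := eqVneq t p.
  by rewrite Fp /c divfK // addrN.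
have [->|tx] := eqVneq t x.
  rewrite {2}/adj edge_irr mulr0 addr0 Fx big1 // => u _.
  have [uS|uS] := boolP (u \in S :\ x :\ p); last by rewrite supp ?mulr0.
  rewrite /adj; case: ifP => [xu|_]; last by rewrite mul0r.
  by move: uS; rewrite !inE => /and3P[/eqP up _ uS]; case: up; apply: lx.
rewrite eqn ?inE ?tp ?tx // /adj; case: ifP => [|_]; last by rewrite mulr0 addr0.
by rewrite edge_sym => /(lx t tS)/eqP; rewrite (negPf tp).
Qed.

(** If some maximum matching of the forest [S] misses [v], then a kernel vector of
    its adjacency matrix has value [1] at [v]; otherwise the unit vector at [v] has
    a preimage vanishing at [v].  The induction removes a vertex [x] other than [v],
    isolated or a leaf, in the latter case together with its neighbour [p]; the
    leaf settles the question at once when [p] is [v]. *)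
Lemma forest_solution S v : forest S -> v \in S ->
  if nu (S :\ v) == nu S then exists2 z, solves S z (fun=> 0) & z v = 1
  else exists2 z, solves S z (fun t => (t == v)%:R) & z v = 0.
Proof.
have [k] := ubnP #|S|; elim: k S => // k IH S leS fS vS.
have [SE|nS] := eqVneq S [set v].
  rewrite nu_isolated ?eqxx; last first.
    by apply/eqP/deg0P => y; rewrite SE inE => /eqP ->; rewrite edge_irr.
  exists (fun u => (u == v)%:R); last by rewrite eqxx.
  split=> [u|t]; rewrite SE inE; first by move/negPf ->.
  move/eqP ->.
  rewrite (bigD1 v) //= /adj edge_irr mul0r add0r big1 // => u /negPf ->.
  by rewrite mulr0.
have [x] := forest_leaf fS vS nS; rewrite !inE => /andP[xv xS] dx.
have vx : (v == x) = false by rewrite eq_sym (negPf xv).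
have fx := forest_sub fS (subD1set S x).
have [d0|d1] := posnP (deg S x).
  have := IH (S :\ x); rewrite (cardsD1 x S) xS in leS; move=> /(_ leS fx).
  rewrite !inE vS vx => /(_ isT).
  have -> : S :\ x :\ v = S :\ v :\ x by rewrite !setDDl setUC.
  have d0' : deg (S :\ v) x = 0%N.
    by apply/eqP; rewrite -leqn0 -d0 deg_sub // subD1set.
  rewrite (nu_isolated d0) (nu_isolated d0').
  by case: ifP => _ [z sz zv]; exists z => //; apply: solves_isolated sz => //; rewrite (negPf xv).
have /deg_gt0P[p pS xp] := d1.
have lx y : y \in S -> edge x y -> y = p.
  move=> yS xy; apply/eqP; apply: contraTT dx => yp; rewrite -ltnNge.
  apply: (@leq_deg _ _ S x [:: y; p]) => [|u]; first by rewrite /= inE yp.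
  by rewrite !inE => /orP[]/eqP ->; rewrite ?yS ?pS.
have px : (p == x) = false by apply: contraTF xp => /eqP ->; rewrite edge_irr.
have [pv|pv] := eqVneq p v.
  subst p; rewrite (nu_leaf xS pS xp lx).
  have -> : S :\ x :\ v = S :\ v :\ x by rewrite !setDDl setUC.
  rewrite (@nu_isolated _ _ (S :\ v) x); last first.
    apply/eqP/deg0P => y; rewrite !inE => /andP[yv yS]; apply/negP => /(lx y yS)/eqP.
    by rewrite (negPf yv).
  rewrite ltn_eqF //.
  have xv0 : adj v x != 0 by rewrite /adj edge_sym xp gt_eqF // wt_gt0 // edge_sym.
  exists (fun u => (u == x)%:R / adj v x); last by rewrite vx mul0r.
  split=> [u uS|t tS].
    by case: eqP => [ux|_]; rewrite ?mul0r //; rewrite ux xS in uS.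
  rewrite (bigD1 x) //= eqxx big1 ?addr0 => [|u /negPf ->]; last by rewrite mul0r mulr0.
  rewrite mul1r; have [->|tv] := eqVneq t v; first by rewrite mulfV.
  rewrite /adj; case: ifP => [|_]; last by rewrite mul0r.
  by rewrite edge_sym => /(lx t tS)/eqP; rewrite (negPf tv).
have vS' : v \in S :\ x :\ p by rewrite !inE vS vx eq_sym pv.
have := IH (S :\ x :\ p) _ (forest_sub fx (subD1set _ _)) vS'.
have lt1 : (#|S :\ x :\ p| < k)%N.
  rewrite (cardsD1 x S) xS in leS.
  exact: leq_ltn_trans (subset_leq_card (subD1set _ _)) leS.
move=> /(_ lt1); rewrite (nu_leaf xS pS xp lx).
rewrite (@nu_leaf _ _ (S :\ v) x p) ?inE ?xv ?pv // => [|y]; last first.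
  by rewrite !inE => /andP[_]; apply: lx.
have -> : S :\ x :\ p :\ v = S :\ v :\ x :\ p.
  by apply/setP => u; rewrite !inE; case: (u == x); case: (u == p); case: (u == v).
rewrite eqSS.
by case: ifP => _ [z sz zv]; have [| |z' sz' z'E] := solves_leaf xS pS xp lx _ _ sz;
  rewrite ?(negPf xv) ?(negPf pv) //; exists z'; rewrite ?z'E ?vx.
Qed.

End Forests.

Section Trees.
Variables (R : rcfType) (G : wgraph R) (v : G).
Hypothesis treeG : is_tree G.
Local Open Scope ring_scope.

Let sol := forest_solution (tree_forest treeG) (in_setT v).

Lemma tree_mismatched : mismatched v ->
  exists2 z : G -> R, forall t, \sum_u adj t u * z u = 0 & z v = 1.
Proof.
by have := sol; rewrite mismatchedE setTD => /[swap] -> [z [_ sz] zv]; exists z => // t; rewrite sz.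
Qed.

Lemma tree_matched : matched v ->
  exists2 z : G -> R, forall t, \sum_u adj t u * z u = (t == v)%:R & z v = 0.
Proof.
have := sol; rewrite /matched mismatchedE setTD => /[swap] /negPf -> [z [_ sz] zv].
by exists z => // t; rewrite sz.
Qed.

End Trees.

(** * Branches of a bicyclic graph *)

Section Branches.
Variables (R : rcfType) (G : wgraph R) (X : {set G}).
(** [G] is bicyclic, and [X] satisfies the two properties of a base that are used. *)
Hypothesis connG : conn [set: G].
Hypothesis arcsG : arcs [set: G] = 2 * #|G| + 2.
Hypothesis arcsX : 2 * #|X| + 2 <= arcs X.
Hypothesis degX : forall x, x \in X -> 1 < deg X x.

Section OneBranch.
Variable v : G.
Hypothesis vX : v \in X.
Let T := branch X v.

Lemma branchP :
  [/\ T :&: X = [set v], conn T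
    & forall S, S :&: X = [set v] -> conn S -> #|S| <= #|T|].
Proof.
rewrite /T /branch.
have Pv : ([set v] :&: X == [set v]) && connected_graph (induced [set v]).
  by apply/andP; split; [apply/eqP/setIidPl; rewrite sub1set|apply/connected_induced/conn1].
case: (@arg_maxnP _ _ (fun S => (S :&: X == [set v]) && connected_graph (induced S)) _ Pv).
move=> S /andP[/eqP SX /connected_induced cS] maxS; split=> // S' SX' cS'.
by apply: maxS; rewrite SX' eqxx; apply/connected_induced.
Qed.

Lemma branchI : T :&: X = [set v]. Proof. by case: branchP. Qed.
Lemma branch_conn : conn T. Proof. by case: branchP. Qed.

Lemma mem_branch : v \in T.
Proof. by have /setIP[] : v \in T :&: X by rewrite branchI set11. Qed.

Lemma branch_base u : u \in T -> u \in X -> u = v.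
Proof. by move=> uT uX; apply/set1P; rewrite -branchI inE uT. Qed.

(** By maximality, a branch absorbs the neighbours of its vertices off the base. *)
Lemma branch_max t y : t \in T -> edge t y -> y \notin X -> y \in T.
Proof.
move=> tT ty yX; case: branchP => TX cT maxT; apply: contraT => yT.
have := maxT (y |: T); rewrite cardsU1 yT ltnn; apply.
  by rewrite setIUl TX (_ : [set y] :&: X = set0) ?set0U //; apply/disjoint_setI0; rewrite disjoints1.
exact: connU1 cT tT ty.
Qed.

(** The union of the branch and the base spans at most one edge more than its number
    of vertices, and the base already accounts for this excess: the branch is a tree
    and, apart from its root, is not adjacent to the base. *)
Lemma branch_count : arcs T + 2 = 2 * #|T| /\ cross (T :\ v) (X :\ v) = 0.
Proof.
have vT := mem_branch.
have dis : [disjoint T & X :\ v].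
  rewrite -setI_eq0; apply/eqP/setP => u; rewrite !inE.
  by apply/and3P => -[uT uv /(branch_base uT)/eqP]; rewrite (negPf uv).
have growth := @arcs_growth _ _ (T :|: X :\ v) _ connG (subsetT _) _.
have {growth} : arcs (T :|: X :\ v) + 2 * #|G| <= 2 * #|G| + 2 + 2 * #|T :|: X :\ v|.
  by rewrite -arcsG -[in X in X <= _]cardsT growth //; apply/set0Pn; exists v; rewrite inE vT.
rewrite arcsU // cardsU disjoint_setI0 // cards0 subn0.
have := arcsX; rewrite (cardsD1 v X) vX -(setD1K vX) arcsU1 ?setD11 // setD1K //.
have -> : cross T (X :\ v) = deg (X :\ v) v + cross (T :\ v) (X :\ v).
  by rewrite /cross (big_setD1 v).
by have := arcs_conn branch_conn; lia.
Qed.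

(** Only the root of a branch has neighbours outside it. *)
Lemma branch_edge t y : t \in T -> t != v -> edge t y -> y \in T.
Proof.
move=> tT tv ty; have [yX|] := boolP (y \in X); last exact: branch_max ty.
have [-> |yv] := eqVneq y v; first exact: mem_branch.
have [_ /eqP] := branch_count; rewrite sum_nat_eq0 => /forall_inP/(_ t).
by rewrite !inE tT tv => /(_ isT)/deg0P/(_ y); rewrite !inE yv yX ty => /(_ isT).
Qed.

Lemma branch_tree : is_tree (induced T).
Proof.
apply/andP; split; first exact/connected_induced/branch_conn.
by have := arcs_edges_induced T; have [+ _] := branch_count; rewrite card_induced; lia.
Qed.

(** A component [K] of the complement of the branch is adjacent to the rest [C] of
    the graph at [v] only.  If [v] has two neighbours in [K], the bound follows from
    the connectedness of [C].  If it has only one, all the vertices of the base in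
    [C] other than [v] keep two base neighbours in [C], and [v] keeps one, so that
    [C] spans at least [#|C|] edges and [K] at most [#|K|]. *)
Lemma component_count (K : {set G}) : conn K -> K \subset ~: T ->
  (forall x y, x \in K -> y \notin T -> edge x y -> y \in K) -> arcs K <= 2 * #|K|.
Proof.
move=> cK sK clK; have vT := mem_branch.
have vK : v \notin K by apply: contraL vT => /(subsetP sK); rewrite inE.
have only_v x y : x \in K -> y \notin K -> edge x y -> y = v.
  move=> xK yK xy; apply/eqP; apply: contraNT yK => yv.
  apply: clK (xy) => //; apply/negP => yT; have := subsetP sK x xK.
  by rewrite inE (branch_edge yT yv) // edge_sym.
pose C := ~: K.
have vC : v \in C by rewrite inE.
have dKC : [disjoint K & C] by rewrite -setI_eq0 setICr.
have cardG : #|K| + #|C| = #|G| by rewrite cardsC.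
have := arcsG; rewrite -(setUCr K) arcsU // -/C.
have -> : cross K C = deg K v.
  rewrite crossC /cross (big_setD1 v) //= big1 ?addn0 // => x.
  rewrite !inE => /andP[xv xK]; apply/eqP/deg0P => y yK; apply/negP.
  by rewrite edge_sym => /(only_v y x yK xK)/eqP; rewrite (negPf xv).
have d0 : 0 < deg K v.
  rewrite lt0n; apply/negP => /deg0P dK; have [K0 _] := cK.
  have /setP/(_ v) : K = [set: G]; last by rewrite inE (negPf vK).
  apply: connG.2 => // x y xK _ xy; apply/negPn/negP => yK.
  by have := dK x xK; rewrite -(only_v x y xK yK xy) edge_sym xy.
have cC : conn C.
  (* an edgeless cut of [C] has a side avoiding [v], which would be cut off in [G] *)
  have cut (A : {set G}) : A \subset C -> A != set0 -> v \notin A ->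
      (forall x y, x \in A -> y \in C -> edge x y -> y \in A) -> False.
    move=> sA A0 vA clA; have /setP/(_ v) : A = [set: G]; last by rewrite inE (negPf vA).
    apply: connG.2 => // x y xA _ xy; have [yK|yK] := boolP (y \in K); last first.
      by apply: clA xy; rewrite // inE.
    have xK : x \notin K by have := subsetP sA x xA; rewrite inE.
    by move: vA; rewrite -(only_v y x yK xK) ?xA // edge_sym.
  split=> [|A sA A0 clA]; first by apply/set0Pn; exists v.
  have [vA|vA] := boolP (v \in A); last by case: (cut A).
  apply/eqP; rewrite eqEsubset sA -setD_eq0; apply: contraT => D0.
  case: (cut (C :\: A)) => //; rewrite ?subsetDl // ?inE ?vA //.
  move=> x y; rewrite !inE => /andP[xA xC] yC xy; rewrite yC andbT.
  by apply: contra xA => yA; apply: (clA y); rewrite ?inE // edge_sym.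
have [d2|d1] := ltnP 1 (deg K v).
  by have := arcs_conn cC; lia.
suff : 2 * #|C| <= arcs C by lia.
have splitX u : deg X u = deg (X :&: C) u + deg (X :&: K) u.
  have disXC : [disjoint X :&: C & X :&: K].
    by rewrite -setI_eq0 setIACA [C :&: K]setIC (disjoint_setI0 dKC) setI0.
  by rewrite -degU // -setIUr setUC setUCr setIT.
have vXC : v \in X :&: C by rewrite inE vX.
have deg_v : 0 < deg (X :&: C) v.
  have := degX vX; rewrite splitX; have := deg_sub v (subsetIr X K); lia.
have deg_u u : u \in X :&: C -> u != v -> 1 < deg (X :&: C) u.
  rewrite inE => /andP[uX uC] uv; have := degX uX; rewrite splitX.
  suff -> : deg (X :&: K) u = 0 by rewrite addn0.
  apply/eqP/deg0P => y; rewrite inE => /andP[_ yK]; apply/negP.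
  rewrite edge_sym => /(only_v y u yK _) uE; rewrite uE ?eqxx // in uv.
  by rewrite inE in uC.
have := arcs_geq_except vXC deg_v deg_u.
have := arcs_growth cC (subsetIr X C) ltac:(by apply/set0Pn; exists v); lia.
Qed.

(** The summands are the classes of the connectivity relation. *)
Lemma delete_branch_disjoint_union :
  is_disjoint_union (fun H => is_unicyclic H || is_tree H) (delete T).
Proof.
set H := delete T.
have eqc : {in [set: H] & &, equivalence_rel (connect (@edge R H))}.
  move=> x y z _ _ _; split=> [|xy]; first exact: connect0.
  exact: (same_connect (sym_connect_sym (@edge_sym R H)) xy).
set P := equivalence_partition (connect (@edge R H)) [set: H].
have partP : partition P [set: H] := equivalence_partitionP eqc.
exists P; split=> // [x y xy|K KP].
  have /and3P[/eqP coverP trivP _] := partP.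
  apply/eqP; rewrite eq_pblock ?coverP ?inE //.
  by rewrite (pblock_equivalence_partition eqc) ?inE // connect1.
have clK x y : x \in K -> edge x y -> y \in K.
  move=> xK xy; have /and3P[_ trivP _] := partP.
  rewrite -(def_pblock trivP KP xK) (pblock_equivalence_partition eqc) ?inE //.
  exact: connect1.
have cK : conn K.
  have /and3P[_ trivP P0] := partP; split; first by apply: contraNneq P0 => <-.
  move=> A sA /set0Pn[a aA] clA; apply/eqP; rewrite eqEsubset sA.
  have aK := subsetP sA a aA; apply/subsetP => y.
  rewrite -(def_pblock trivP KP aK) (pblock_equivalence_partition eqc) ?inE // => ay.
  suff clo : closed (@edge R H) (mem A) by have := closed_connect clo ay; rewrite /= aA => <-.
  apply: intro_closed; first exact/sym_connect_sym/edge_sym.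
  move=> u w uw uA; apply: (clA u) => //.
  exact: clK (subsetP sA u uA) uw.
have := @component_count [set val u | u in K] (iffLR (conn_induced K) cK).
rewrite -arcs_induced card_imset; last exact: val_inj.
move=> upper; have {upper} : arcs K <= 2 * #|K|.
  apply: upper; first by apply/subsetP => _ /imsetP[u uK ->]; exact: valP u.
  move=> _ y /imsetP[u uK ->] yT uy; have yT' : y \in ~: T by rewrite inE.
  by apply/imsetP; exists (Sub y yT') => //; apply: clK uK _.
have := arcs_conn cK; rewrite arcs_edges_induced /is_unicyclic /is_tree card_induced.
rewrite (introT (connected_induced K) cK) /=; lia.
Qed.

Local Open Scope ring_scope.

(** Extension by zero of a vector indexed by the branch. *)
Lemma extend_vector (z : induced T -> R) : exists z' : G -> R,
  [/\ forall u, u \notin T -> z' u = 0, forall u : induced T, z' (val u) = z u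
    & forall t : induced T,
        \sum_(u in T) adj (val t) u * z' u = \sum_(u : induced T) adj t u * z u].
Proof.
pose z' u := if insub u is Some u' then z u' else 0.
have z'val u : z' (val u) = z u by rewrite /z' valK.
exists z'; split=> // [u uT|t]; first by rewrite /z' insubN.
by rewrite -sum_induced; apply: eq_bigr => u _; rewrite z'val.
Qed.

Lemma inertia_matched_branch : matched_in T v ->
  i_pos G = (i_pos (induced T) + i_pos (delete T))%N /\
  i_neg G = (i_neg (induced T) + i_neg (delete T))%N.
Proof.
case/existsP => v' /andP[/eqP v'v mv'].
have [z zE zv] := tree_matched branch_tree mv'.
have [z' [_ z'val z'E]] := extend_vector z.
have adj0 t c : t \in T -> c \notin T -> t != v -> adj t c = 0.
  by move=> tT cT tv; rewrite /adj; case: ifP => // /(branch_edge tT tv); rewrite (negPf cT).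
apply: (inertia_schur_graph (Y := fun u c => z' u * adj v c)).
  move=> t c tT cT; under eq_bigr do rewrite mulrA.
  rewrite -mulr_suml -[t]/(val (Sub t tT : induced T)) z'E zE -val_eqE /= v'v.
  by case: eqVneq => [->|tv]; rewrite ?mul1r // mul0r adj0.
move=> c c' cT _; rewrite big1 // => u uT; have [->|uv] := eqVneq u v.
  by rewrite -v'v z'val zv mul0r mulr0.
by rewrite adj_sym adj0 // mul0r.
Qed.

Lemma unmatched_branch_vector : ~~ matched_in T v ->
  exists z : G -> R, [/\ forall u, u \notin T -> z u = 0, z v = 1
    & forall t, t \in T -> \sum_(u in T) adj t u * z u = 0].
Proof.
rewrite negb_exists => /forallP/(_ (Sub v mem_branch)).
rewrite /= eqxx /= negbK => mv.
have [z zE zv] := tree_mismatched branch_tree mv.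
have [z' [supp z'val z'E]] := extend_vector z; exists z'; split=> // [|t tT].
  by rewrite -zv -z'val.
by rewrite -[t]/(val (Sub t tT : induced T)) z'E zE.
Qed.

End OneBranch.

Local Open Scope ring_scope.

Lemma inertia_type_II : type_II X ->
  i_pos G = (i_pos (delete X) + i_pos (induced X))%N /\
  i_neg G = (i_neg (delete X) + i_neg (induced X))%N.
Proof.
move=> tII.
have /fin_all_exists[z zP] (c : G) : exists zc : G -> R, c \in X ->
    [/\ forall u, u \notin branch X c -> zc u = 0, zc c = 1
      & forall t, t \in branch X c -> \sum_(u in branch X c) adj t u * zc u = 0].
  case: (boolP (c \in X)) => cX; last by exists (fun=> 0).
  have mc : ~~ matched_in (branch X c) c by apply/negP => mc; apply: tII; exists c.
  by have [zc zcP] := unmatched_branch_vector cX mc; exists zc.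
(* [z c] vanishes on the base except at [c], where it is [1] *)
have sumE c t : c \in X ->
    \sum_(u in ~: X) adj t u * - z c u =
    adj t c - \sum_(u in branch X c) adj t u * z c u.
  move=> cX; have [supp zc _] := zP c cX.
  rewrite [X in _ = _ - X](big_setD1 c) ?mem_branch //= zc mulr1 opprD addrA subrr add0r -sumrN.
  under eq_bigr do rewrite mulrN.
  rewrite big_mkcond [RHS]big_mkcond; apply: eq_bigr => u _ /=; rewrite !inE.
  have [uT|uT] := boolP (u \in branch X c); last by rewrite supp // mulr0 oppr0 andbF; case: ifP.
  rewrite andbT; have [uX|uX] := boolP (u \in X).
    by rewrite (branch_base cX uT uX) eqxx.
  by case: eqP => // uc; rewrite uc cX in uX.
have := @inertia_schur_graph R G (~: X) (fun u c => - z c u).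
rewrite /delete setCK; apply=> [t c|c' c]; rewrite !inE ?negbK => tX cX; rewrite sumE //.
  have [supp zc zE] := zP c cX.
  have [tT|tT] := boolP (t \in branch X c); first by rewrite zE // subr0.
  rewrite big1 ?subr0 // => u uT; rewrite adj_sym /adj; case: ifP => [ut|]; last by rewrite mul0r.
  by rewrite (branch_max cX uT ut tX) in tT.
have [supp zc zE] := zP c cX; have cT := mem_branch cX.
have [->|cc] := eqVneq c' c; first by rewrite zE // /adj edge_irr subrr.
rewrite (big_setD1 c) //= zc mulr1 big1 ?addr0 ?subrr // => u; rewrite !inE => /andP[uc uT].
rewrite adj_sym /adj; case: ifP => [uc'|]; last by rewrite mul0r.
by have /eqP := branch_base cX (branch_edge cX uT uc uc') tX; rewrite (negPf cc).
Qed.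

End Branches.

(** * Degrees in the base *)

Section Consecutive.
Variable T : eqType.
Implicit Types (a b x y z : T) (s t : seq T).

Lemma consecutive_cat s t x y : consecutive (s ++ [:: x, y & t]) x y.
Proof. by apply/orP; left; apply/infixP; exists s, t. Qed.

Lemma consecutiveC s x y : consecutive s x y = consecutive s y x.
Proof. by rewrite /consecutive orbC. Qed.

Lemma consecutive_head a b s : consecutive (a :: rcons s b) a (head b s).
Proof. by case: s => [|x s]; apply: (consecutive_cat [::]). Qed.

Lemma consecutive_last a b s : consecutive (a :: rcons s b) b (last a s).
Proof.
rewrite consecutiveC -rcons_cons lastI -!cats1 -catA.
exact: (consecutive_cat (belast a s) [::]).
Qed.

(** An inner vertex of a path, or of a cycle cut at a vertex, has two distinct
    neighbours along it. *)
Lemma consecutive_inner a b s x : uniq s -> a \notin s -> b \notin s ->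
  (a != b) || (1 < size s) -> x \in s ->
  exists y z, [/\ y != z, consecutive (a :: rcons s b) x y
                & consecutive (a :: rcons s b) x z].
Proof.
move=> us aS bS ab xs; case/splitPr: xs us aS bS ab => s1 s2 us aS bS ab.
exists (last a s1), (head b s2); split.
- case/lastP: s1 us aS bS ab => [|s1 y] us aS bS ab; case: s2 us aS bS ab => [|z s2] /= us aS bS ab.
  + by rewrite orbF in ab.
  + by apply: contraNneq aS => ->; rewrite !inE eqxx orbT.
  + by apply: contraNneq bS => <-; rewrite mem_cat last_rcons mem_rcons inE eqxx.
  rewrite last_rcons; apply: contraTneq us => ->.
  by rewrite cat_uniq /= !mem_rcons !inE eqxx !orbT /= andbF.
- rewrite consecutiveC rcons_cat -cat_cons lastI -cats1 -catA.
  exact: consecutive_cat.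
rewrite rcons_cat -cat_cons; case: s2 {us aS bS ab} => [|z s2] /=;
  exact: (consecutive_cat (a :: s1)).
Qed.

Lemma head_neq b s t : b \notin s -> b \notin t -> ~~ has (mem s) t ->
  (s != [::]) || (t != [::]) -> head b s != head b t.
Proof.
case: s => [|x s]; case: t => [|y t] //= bs bt dis _.
- by apply: contraNneq bt => ->; rewrite inE eqxx.
- by apply: contraNneq bs => <-; rewrite inE eqxx.
by apply: contraNneq dis => ->; rewrite inE eqxx.
Qed.

Lemma last_neq b s t : b \notin s -> b \notin t -> ~~ has (mem s) t ->
  (s != [::]) || (t != [::]) -> last b s != last b t.
Proof.
case/lastP: s => [|s x]; case/lastP: t => [|t y] //; rewrite ?last_rcons /=.
- by move=> _ bt _ _; apply: contraNneq bt => ->; rewrite mem_rcons inE eqxx.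
- by move=> bs _ _ _; apply: contraNneq bs => <-; rewrite mem_rcons inE eqxx.
move=> _ _ dis _; apply: contraNneq dis => ->; apply/hasP; exists y => /=;
  by rewrite mem_rcons inE eqxx.
Qed.

Lemma head_mem b s : s != [::] -> head b s \in s.
Proof. by case: s => // x s _; rewrite inE eqxx. Qed.

Lemma last_mem b s : s != [::] -> last b s \in s.
Proof. by case: s => // x s _; rewrite /= mem_last. Qed.

Lemma head_neq_last b s : uniq s -> 1 < size s -> head b s != last b s.
Proof.
case: s => // x [|y s] //= /andP[xs _] _.
by apply: contraNneq xs => ->; rewrite mem_last.
Qed.

End Consecutive.

Section Base.
Variable R : rcfType.

(** All degrees are at least two, and the excesses over two sum to at least two:
    one vertex of degree at least four, or two of degree at least three. *)
Definition excess_degree (H : wgraph R) : Prop :=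
  (forall x : H, 1 < deg [set: H] x) /\
  ((exists x : H, 3 < deg [set: H] x) \/
   (exists x y : H, [/\ x != y, 2 < deg [set: H] x & 2 < deg [set: H] y])).

Lemma excess_arcs (H : wgraph R) : excess_degree H -> 2 * #|H| + 2 <= arcs [set: H].
Proof.
have sum_geq (A : {set H}) : (forall x : H, 1 < deg [set: H] x) ->
    2 * #|A| <= \sum_(x in A) deg [set: H] x.
  move=> d2; rewrite -sum1_card big_distrr /=; apply: leq_sum => x _.
  by rewrite muln1.
case=> d2 [[x dx]|[x [y [xy dx dy]]]]; rewrite -cardsT /arcs.
  rewrite (big_setD1 x) ?inE //= (cardsD1 x) inE.
  by have := sum_geq ([set: H] :\ x) d2; lia.
have yD : y \in [set: H] :\ x by rewrite !inE eq_sym xy.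
rewrite (big_setD1 x) ?inE //= (big_setD1 y) //= (cardsD1 x) inE (cardsD1 y (_ :\ _)) yD.
by have := sum_geq ([set: H] :\ x :\ y) d2; lia.
Qed.

Lemma deg_lower (H : wgraph R) (x : H) (s : seq H) :
  uniq s -> all (edge x) s -> size s <= deg [set: H] x.
Proof. by move=> us /allP sx; apply: leq_deg => // y /sx ->; rewrite inE. Qed.

(** The degree four vertex is the common vertex of the two cycles; when they are
    joined by a path of positive length, its ends have degree three. *)
Lemma infty_excess p l q (H : wgraph R) : 3 <= p -> 3 <= q ->
  is_infty_graph p l q H -> excess_degree H.
Proof.
move=> p3 q3 [u [c [m [d]]]] /=; set v := last u m.
case=> -[cp _ dq] U cover E.
have c2 : 1 < size c by lia.
have d2 : 1 < size d by lia.
have c0 : c != [::] by case: (c) c2.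
have d0 : d != [::] by case: (d) d2.
have edge_c x y : consecutive (u :: rcons c u) x y -> edge x y by rewrite E => ->.
have edge_m x y : consecutive (u :: m) x y -> edge x y by rewrite E => ->; rewrite orbT.
have edge_d x y : consecutive (v :: rcons d v) x y -> edge x y.
  by rewrite E => ->; rewrite !orbT.
move: U; rewrite -cat_cons cat_uniq has_cat negb_or => /and3P[uc /andP[dis_cm dis_cd]].
rewrite cat_uniq => /and3P[um dis_md ud].
have um_c x : x \in u :: m -> x \notin c by move/(hasPn dis_cm).
have d_c x : x \in d -> x \notin c by move/(hasPn dis_cd).
have d_um x : x \in d -> x \notin u :: m by move/(hasPn dis_md).
have uC : u \notin c by rewrite um_c // inE eqxx.
have vD : v \notin d by apply/negP => /d_um; rewrite mem_last.
have hc := head_mem u c0; have lc := last_mem u c0.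
have hd := head_mem v d0; have ld := last_mem v d0.
have nc := head_neq_last u uc c2; have nd := head_neq_last v ud d2.
have ec1 : edge u (head u c) by apply/edge_c/consecutive_head.
have ec2 : edge u (last u c) by apply/edge_c/consecutive_last.
have ed1 : edge v (head v d) by apply/edge_d/consecutive_head.
have ed2 : edge v (last v d) by apply/edge_d/consecutive_last.
have du : 1 < deg [set: H] u.
  by apply: (@deg_lower _ _ [:: head u c; last u c]); rewrite /= ?inE ?nc ?ec1 ?ec2.
have dv : 1 < deg [set: H] v.
  by apply: (@deg_lower _ _ [:: head v d; last v d]); rewrite /= ?inE ?nd ?ed1 ?ed2.
have inner a b s x : (forall x y, consecutive (a :: rcons s b) x y -> edge x y) ->
    uniq s -> a \notin s -> b \notin s -> (a != b) || (1 < size s) -> x \in s ->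
    1 < deg [set: H] x.
  move=> es us aS bS ab xs.
  have [y [z [yz xy xz]]] := consecutive_inner us aS bS ab xs.
  by apply: (@deg_lower _ _ [:: y; z]); rewrite /= ?inE ?yz ?(es x y xy) ?(es x z xz).
have neq_cd x y : x \in c -> y \in d -> x != y.
  by move=> xc yd; apply: contraTneq xc => ->; apply: d_c.
have neq_cm x y : x \in c -> y \in u :: m -> x != y.
  by move=> xc yd; apply: contraTneq xc => ->; apply: um_c.
have neq_dm x y : x \in d -> y \in u :: m -> x != y.
  by move=> xc yd; apply: contraTneq yd => <-; apply: d_um.
split.
  move=> x; have := cover x; rewrite -cat_cons !mem_cat => /or3P[xc|xm|xd].
  - by apply: (inner u u c) => //; rewrite c2 orbT.
  - move: xm; rewrite inE => /orP[/eqP -> //|].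
    move: um edge_m dv; rewrite /v; case/lastP: (m) => // m' w.
    rewrite last_rcons mem_rcons inE => um edge_m dv /orP[/eqP -> //|xm'].
    move: um; rewrite /= mem_rcons rcons_uniq inE negb_or => /and3P[/andP[uw um'] wm' um''].
    by apply: (inner u w m'); rewrite ?uw.
  by apply: (inner v v d) => //; rewrite d2 orbT.
have [m0|m0] := eqVneq m [::].
  have uv : v = u by rewrite /v m0.
  left; exists u.
  apply: (@deg_lower _ _ [:: head u c; last u c; head v d; last v d]); rewrite /= ?inE.
    by rewrite !negb_or nc nd !neq_cd.
  by rewrite ec1 ec2 -{1}uv ed1 -uv ed2.
right; exists u, v.
have vm : v \in m by rewrite /v; case: (m) m0 => // w m' _; rewrite /= mem_last.
have uv : u != v by apply: contraTneq um => ->; rewrite /= vm.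
have [m' mE] : exists m', m = rcons m' v.
  by rewrite /v; case/lastP: (m) m0 => // m' w _; rewrite last_rcons; exists m'.
split=> //.
  apply: (@deg_lower _ _ [:: head u c; last u c; head v m']); rewrite /= ?inE.
    have hm : head v m' \in u :: m.
      by rewrite mE; case: (m') => [|w m'']; rewrite /= !inE eqxx orbT.
    by rewrite !negb_or nc !neq_cm.
  rewrite ec1 ec2 edge_m //= mE; exact: consecutive_head.
apply: (@deg_lower _ _ [:: head v d; last v d; last u m']); rewrite /= ?inE.
  have lm : last u m' \in u :: m.
    by rewrite mE -rcons_cons mem_rcons inE mem_last orbT.
  by rewrite !negb_or nd !neq_dm.
rewrite ed1 ed2 edge_m //= mE; exact: consecutive_last.
Qed.

Lemma theta_excess p l q (H : wgraph R) : count_mem 2 [:: p; l; q] <= 1 ->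
  is_theta_graph p l q H -> excess_degree H.
Proof.
move=> cnt [a [b [s1 [s2 [s3]]]]] [[]]; rewrite /= !size_rcons => pE lE qE U cover E.
have ne12 : (s1 != [::]) || (s2 != [::]).
  by move: pE lE cnt; case: (s1); case: (s2) => //= <- <-; rewrite ?eqxx.
have ne13 : (s1 != [::]) || (s3 != [::]).
  by move: pE qE cnt; case: (s1); case: (s3) => //= <- <-; rewrite !eqxx; case: (_ == 2).
have ne23 : (s2 != [::]) || (s3 != [::]).
  by move: lE qE cnt; case: (s2); case: (s3) => //= <- <-; rewrite !eqxx; case: (_ == 2).
have e1 x y : consecutive (a :: rcons s1 b) x y -> edge x y by rewrite E => ->.
have e2 x y : consecutive (a :: rcons s2 b) x y -> edge x y by rewrite E => ->; rewrite orbT.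
have e3 x y : consecutive (a :: rcons s3 b) x y -> edge x y by rewrite E => ->; rewrite !orbT.
move: U; rewrite !inE !mem_cat !negb_or !cat_uniq has_cat negb_or.
case/and4P=> /and4P[ab a1 a2 a3] /and3P[b1 b2 b3] u1 /and4P[/andP[d12 d13] u2 d23 u3].
have inner s x : (forall x y, consecutive (a :: rcons s b) x y -> edge x y) ->
    uniq s -> a \notin s -> b \notin s -> x \in s -> 1 < deg [set: H] x.
  move=> es us aS bS xs.
  have ab' : (a != b) || (1 < size s) by rewrite ab.
  have [y [z [yz xy xz]]] := consecutive_inner us aS bS ab' xs.
  by apply: (@deg_lower _ _ [:: y; z]); rewrite /= ?inE ?yz ?(es x y xy) ?(es x z xz).
have da : 2 < deg [set: H] a.
  apply: (@deg_lower _ _ [:: head b s1; head b s2; head b s3]); rewrite /= ?inE.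
    by rewrite !negb_or !head_neq.
  by rewrite e1 ?consecutive_head // e2 ?consecutive_head // e3 ?consecutive_head.
have db : 2 < deg [set: H] b.
  apply: (@deg_lower _ _ [:: last a s1; last a s2; last a s3]); rewrite /= ?inE.
    by rewrite !negb_or !last_neq.
  by rewrite e1 ?consecutive_last // e2 ?consecutive_last // e3 ?consecutive_last.
split; last by right; exists a, b.
move=> x; have := cover x; rewrite !inE !mem_cat.
case/or4P=> [/eqP ->|/eqP ->|xs|/orP[]xs]; try exact: ltnW.
- exact: (inner s1).
- exact: (inner s2).
exact: (inner s3).
Qed.

Lemma base_degrees (G : wgraph R) (X : {set G}) : is_base X ->
  2 * #|X| + 2 <= arcs X /\ forall x, x \in X -> 1 < deg X x.
Proof.
move=> bX; have exX : excess_degree (induced X).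
  case: bX => -[p [l [q]]] []; last by move=> _; apply: theta_excess.
  by move=> p3 _ q3; apply: infty_excess.
have := excess_arcs exX; rewrite arcs_induced imset_valT card_induced; split=> // x xX.
by have := exX.1 (Sub x xX); rewrite deg_induced imset_valT.
Qed.

End Base.

Theorem theorem4p10 (R : rcfType) (B : wgraph R) (X : {set B})
    (hB : is_bicyclic B) (hX : is_base X) :
  (type_I X ->
     forall v : B, v \in X -> matched_in (branch X v) v ->
       [/\ i_pos B = i_pos (induced (branch X v)) + i_pos (delete (branch X v)),
           i_neg B = i_neg (induced (branch X v)) + i_neg (delete (branch X v)),
           is_tree (induced (branch X v))
         & is_disjoint_union (fun H => is_unicyclic H || is_tree H)
             (delete (branch X v))])
  /\
  (type_II X ->
     i_pos B = i_pos (delete X) + i_pos (induced X) /\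
     i_neg B = i_neg (delete X) + i_neg (induced X)).
Proof.
have [arcsX degX] := base_degrees hX.
case/andP: hB => /connected_graphP connB /eqP edgesB.
have arcsB : arcs [set: B] = 2 * #|B| + 2 by rewrite arcs_edges edgesB; lia.
split=> [_ v vX mv|]; last exact: inertia_type_II.
have [pos neg] := inertia_matched_branch connB arcsB arcsX vX mv.
split=> //; first exact: branch_tree.
exact: delete_branch_disjoint_union.
Qed.
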